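(* Let $\lambda>0$, let $f$ be a finite DC function on $\mathbb{R}^n\times\mathbb{R}^m$, and let $\{r_\theta\}_{\theta>0}$ be an admissible family of approximations of the step function (as defined in the context). Suppose that $r_\theta$ is concave on $[0,+\infty)$ for every $\theta>0$, that $K\subset\mathbb{R}^n\times\mathbb{R}^m$ is a polyhedral convex set having at least one vertex, and that $f$ is concave and bounded below on $K$. Then $$\Omega_1=\{(x,y,z)\in\mathbb{R}^n\times\mathbb{R}^m\times\mathbb{R}^n:(x,y)\in K,\ |x_i|\le z_i\ \ \forall i=1,\dots,n\}$$ is also a polyhedral convex set having at least one vertex. Let $\mathcal{V}$ be the vertex set of $\Omega_1$, and for $\theta>0$ let $\overline{\mathcal{P}}_\theta$ be the set of $(x,y)$ for which there exists $z\in\mathbb{R}^n$ such that $(x,y,z)\in\mathcal{V}$ and $(x,y,z)$ is a global solution of $$\min_{(x,y,z)\in\Omega_1} f(x,y)+\lambda\sum_{i=1}^n r_\theta(z_i).$$ Let $\mathcal{P}$ be the set of global solutions of $\min\{f(x,y)+\lambda\|x\|_0:(x,y)\in K\}$. Then $\overline{\mathcal{P}}_\theta\ne\emptyset$ for all $\theta>0$, and there exists $\theta_0>0$ such that $\overline{\mathcal{P}}_\theta\subset\mathcal{P}$ for all $\theta\ge\theta_0$.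
   Context: $\|x\|_0$ is the number of nonzero components of $x\in\mathbb{R}^n$. The function $s:\mathbb{R}\to\mathbb{R}$ is $s(t)=1$ if $t\ne0$ and $s(0)=0$. A finite DC function is a difference $g-h$ of finite convex functions. A family $\{r_\theta\}_{\theta>0}$ of functions $\mathbb{R}\to\mathbb{R}$ is called admissible if: (1) $\lim_{\theta\to+\infty}r_\theta(t)=s(t)$ for all $t\in\mathbb{R}$; (2) for every $\theta>0$, $r_\theta$ is even, i.e. $r_\theta(t)=r_\theta(|t|)$, and increasing (meaning nondecreasing) on $[0,+\infty)$; (3) for every $\theta>0$, $r_\theta=\varphi_\theta-\psi_\theta$ with given finite convex functions $\varphi_\theta,\psi_\theta$ on $\mathbb{R}$; write $\partial r_\theta(t):=\{u-v:u\in\partial\varphi_\theta(t),\,v\in\partial\psi_\theta(t)\}$, where $\partial$ of a convex function is its convex subdifferential; (4) $t\mu\ge0$ for all $\theta>0$, $t\in\mathbb{R}$, $\mu\in\partial r_\theta(t)$; (5) for any $a\le b$ with $0\notin[a,b]$, $\lim_{\theta\to+\infty}\sup\{|z|:z\in\partial r_\theta(t),\,t\in[a,b]\}=0$. *)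

(* Defs.v *)
From HB Require Import structures.
From mathcomp Require Export all_boot all_order all_algebra.
From mathcomp Require Export all_classical all_reals all_analysis.
Export numFieldNormedType.Exports.

Set Implicit Arguments.
Unset Strict Implicit.
Unset Printing Implicit Defensive.

Import Order.TTheory GRing.Theory Num.Theory.

Local Open Scope classical_set_scope.
Local Open Scope ring_scope.

Definition concave_function (R : realType) (E : lmodType R) (C : set E)
    (f : E -> R) : Prop :=
  convex_function C (fun x => - f x).

Definition finite_dc (R : realType) (E : lmodType R) (f : E -> R) : Prop :=
  exists g h : E -> R, [/\ convex_function setT g, convex_function setT h
    & forall x, f x = g x - h x].

(* On the finite-dimensional spaces considered here every linear functional
   is an inner product with a fixed vector, so the sets below are exactly the
   finite intersections of closed half-spaces. *)
Definition polyhedral_convex_set (R : realType) (E : lmodType R)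
    (C : set E) : Prop :=
  exists (k : nat) (a : 'I_k -> {linear E -> R^o}) (b : 'I_k -> R),
    C = [set x | forall i, a i x <= b i].

(* Vertices are extreme points. *)
Definition vertices (R : realType) (E : lmodType R) (C : set E) : set E :=
  [set v | C v /\ forall (x y : E) (t : R), C x -> C y -> 0 < t -> t < 1 ->
    v = t *: x + (1 - t) *: y -> x = y].

Definition global_solutions (R : realType) (T : Type) (F : T -> R)
    (C : set T) : set T :=
  [set x | C x /\ forall y, C y -> F x <= F y].

Definition l0norm (R : realType) (n : nat) (x : 'rV[R]_n) : nat :=
  #|[set i : 'I_n | x ord0 i != 0]%SET|.

Definition step (R : realType) (t : R) : R := if t == 0 then 0 else 1.

Definition subdifferential (R : realType) (phi : R -> R) (t : R) : set R :=
  [set u | forall s, phi t + u * (s - t) <= phi s].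

(* The subdifferential attached to the decomposition [phi - psi]; it depends
   on the pair and not only on the difference. *)
Definition dc_subdifferential (R : realType) (phi psi : R -> R) (t : R) :
    set R :=
  [set z | exists u v, [/\ subdifferential phi t u, subdifferential psi t v
    & z = u - v]].

(* The families are indexed by all of R, but only their members at positive
   indices are constrained. The supremum is taken in \bar R. *)
Record admissible (R : realType) (r phi psi : R -> R -> R) : Prop := {
  adm_cvg : forall t : R, r theta t @[theta --> +oo] --> step t ;
  adm_even : forall theta : R, 0 < theta -> forall t, r theta t = r theta `|t| ;
  adm_nondecreasing : forall theta : R, 0 < theta ->
    forall s t : R, 0 <= s -> s <= t -> r theta s <= r theta t ;
  adm_dc : forall theta : R, 0 < theta ->
    [/\ convex_function (E := R^o) setT (phi theta),
       convex_function (E := R^o) setT (psi theta)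
      & forall t, r theta t = phi theta t - psi theta t] ;
  adm_sign : forall theta : R, 0 < theta -> forall t mu,
    dc_subdifferential (phi theta) (psi theta) t mu -> 0 <= t * mu ;
  adm_flat : forall a b : R, a <= b -> 0 \notin `[a, b] ->
    ereal_sup [set w : \bar R | exists t z : R, [/\ t \in `[a, b],
        dc_subdifferential (phi theta) (psi theta) t z & w = `|z|%:E]]
      @[theta --> +oo] --> 0%E
}.

Definition Omega1 (R : realType) (n m : nat)
    (K : set ('rV[R]_n * 'rV[R]_m)) :
    set ('rV[R]_n * 'rV[R]_m * 'rV[R]_n) :=
  [set w : 'rV[R]_n * 'rV[R]_m * 'rV[R]_n | K w.1 /\
    forall i, `|w.1.1 ord0 i| <= w.2 ord0 i].

Definition l0_solutions (R : realType) (n m : nat) (lambda : R)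
    (f : 'rV[R]_n * 'rV[R]_m -> R) (K : set ('rV[R]_n * 'rV[R]_m)) :
    set ('rV[R]_n * 'rV[R]_m) :=
  global_solutions (fun p => f p + lambda * (l0norm p.1)%:R) K.

Definition vertex_solutions (R : realType) (n m : nat) (lambda : R)
    (f : 'rV[R]_n * 'rV[R]_m -> R) (K : set ('rV[R]_n * 'rV[R]_m))
    (rtheta : R -> R) : set ('rV[R]_n * 'rV[R]_m) :=
  [set p | exists z : 'rV[R]_n, vertices (Omega1 K) (p, z) /\
    global_solutions
      (fun w : 'rV[R]_n * 'rV[R]_m * 'rV[R]_n =>
         f w.1 + lambda * \sum_(i < n) rtheta (w.2 ord0 i))
      (Omega1 K) (p, z)].

(* Main.v *)
(* A concave function bounded below on a pointed polyhedron attains its minimum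
   at a vertex: at a point that is not a vertex there is a direction along which
   every active constraint is constant, and moving along it one way or the other
   until a new constraint becomes active does not increase the function. For
   fixed theta this applies to the penalized problem on [Omega1 K], whose
   objective is concave because z >= 0 there. As the vertices are finitely many,
   it then suffices to see that each single vertex whose (x, y)-part is not an
   l0-solution stops being a minimizer for theta large. *)
From HB Require Import structures.
Require Import Defs.
From mathcomp Require Import ring lra.
Import Order.TTheory GRing.Theory Num.Theory.
Local Open Scope classical_set_scope.
Local Open Scope ring_scope.

(** * Concave functions along a line *)

Lemma concave_functionP {R : realType} {E : lmodType R} (C : set E)
    (f : E -> R) :
  concave_function C f <->
  forall x y t, C x -> C y -> 0 <= t <= 1 ->
    t * f x + (1 - t) * f y <= f (t *: x + (1 - t) *: y).
Proof.
split=> [cf x y t Cx Cy /andP[t0 t1]|cf t x y /set_mem Cx /set_mem Cy].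
  have : - f (t *: x + (1 - t) *: y) <= t * - f x + (1 - t) * - f y
    := cf (Itv01 t0 t1) x y (mem_set Cx) (mem_set Cy).
  lra.
have t01 : 0 <= t%:num <= 1 by rewrite ge0 le1.
have := cf x y t%:num Cx Cy t01.
change (t%:num * f x + (1 - t%:num) * f y
    <= f (t%:num *: (x : E) + (1 - t%:num) *: (y : E)) ->
  - f (t%:num *: (x : E) + (1 - t%:num) *: (y : E))
    <= t%:num * - f x + (1 - t%:num) * - f y).
lra.
Qed.

(** The point [x] is the mean of [x + s *: d] and [x - u *: d] with weights [u / (u + s)] and
    [s / (u + s)]; denominators are cleared. *)
Lemma concave_chord {R : realType} {E : lmodType R} {C : set E} {f : E -> R}
    {x d : E} {s u : R} :
  concave_function C f -> 0 < s -> 0 <= u -> C (x + s *: d) ->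
  C (x - u *: d) ->
  u * f (x + s *: d) + s * f (x - u *: d) <= (u + s) * f x.
Proof.
move=> /concave_functionP cf s0 u0 Cp Cq.
have us0 : 0 < u + s by lra.
have t01 : 0 <= u / (u + s) <= 1.
  by rewrite divr_ge0 ?(ltW us0)//= ler_pdivrMr// mul1r; lra.
have := cf _ _ _ Cp Cq t01.
have -> : 1 - u / (u + s) = s / (u + s) by field; rewrite gt_eqF.
have -> : u / (u + s) *: (x + s *: d) + s / (u + s) *: (x - u *: d) = x.
  rewrite !scalerDr !scalerN !scalerA addrACA -scalerDl.
  have -> : u / (u + s) * s = s / (u + s) * u by ring.
  rewrite subrr addr0.
  suff -> : u / (u + s) + s / (u + s) = 1 by rewrite scale1r.
  by field; rewrite gt_eqF.
rewrite -(ler_pM2l us0); apply: le_trans.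
by rewrite le_eqVlt; apply/orP; left; apply/eqP; field; rewrite gt_eqF.
Qed.

(* Otherwise the slope along the ray would eventually be at most some negative
   constant, contradicting the lower bound. *)
Lemma concave_ray_min {R : realType} {E : lmodType R} {C : set E} {f : E -> R}
    {x d : E} {s M : R} :
  concave_function C f -> (forall y, C y -> M <= f y) -> 0 < s ->
  C (x + s *: d) -> (forall u, 0 <= u -> C (x - u *: d)) ->
  f (x + s *: d) <= f x.
Proof.
move=> cf fM s0 Cp ray; rewrite leNgt; apply/negP => fxp.
have Cx : C x by have := ray 0 (lexx 0); rewrite scale0r subr0.
have Mx := fM _ Cx.
set e := f (x + s *: d) - f x.
have e0 : 0 < e by rewrite subr_gt0.
(* The chord inequality and the bound [M] at [x - u *: d] force [u * e <= s * (f x - M)]; this [u]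
   exceeds that limit by one. *)
pose u := s * (f x - M) / e + 1.
have u0 : 0 <= u by rewrite addr_ge0// divr_ge0 ?(ltW e0)// mulr_ge0; lra.
have := concave_chord cf s0 u0 Cp (ray u u0).
have ue : u * e = s * (f x - M) + e by rewrite /u; field; rewrite gt_eqF.
have := fM _ (ray u u0); rewrite -(ler_pM2l s0).
move: ue; rewrite /e; nra.
Qed.

(** * Active constraints and vertices of a polyhedron *)

Definition polyhedron {R : realType} {E : lmodType R} {k : nat}
    (a : 'I_k -> {linear E -> R^o}) (b : 'I_k -> R) : set E :=
  [set x | forall i, a i x <= b i].

(** Depends on the description [a], [b] and not only on the set, which is why [polyhedron] keeps
    both explicit. *)
Definition active {R : realType} {E : lmodType R} {k : nat}
    (a : 'I_k -> {linear E -> R^o}) (b : 'I_k -> R) (x : E) : {set 'I_k} :=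
  [set i | a i x == b i]%SET.

Lemma linear_line {R : realType} {E : lmodType R} (l : {linear E -> R^o})
    (x d : E) (s : R) :
  l (x + s *: d) = l x + s * l d.
Proof. by rewrite linearD linearZ. Qed.

(** Active constraints do not change along [d], and the finitely many others have positive slack. *)
Lemma polyhedron_wiggle {R : realType} {E : lmodType R} {k : nat}
    {a : 'I_k -> {linear E -> R^o}} {b : 'I_k -> R} {x d : E} :
  polyhedron a b x -> (forall i, i \in active a b x -> a i d = 0) ->
  exists2 e, 0 < e &
    polyhedron a b (x + e *: d) /\ polyhedron a b (x - e *: d).
Proof.
move=> Cx ad0.
suff : \forall e \near (0 : R)^'+, forall i, e * `|a i d| <= b i - a i x.
  move=> H; near ((0 : R)^'+) => e.
  exists e; first by near: e; exact: nbhs_right_gt.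
  have He : forall i, e * `|a i d| <= b i - a i x by near: e.
  have e0 : 0 < e by near: e; exact: nbhs_right_gt.
  split=> i; have := He i; rewrite -?scaleNr linear_line;
    have := ler_norm (a i d); have := ler_norm (- a i d); rewrite normrN; nra.
apply: filter_forall => i.
have [/eqP axb|axb] := boolP (a i x == b i).
  have ai0 : a i d = 0 by apply: ad0; rewrite inE axb.
  by apply: nearW => e; rewrite ai0 normr0 mulr0 axb subrr.
have axb' : 0 < b i - a i x by rewrite subr_gt0 lt_neqAle axb Cx.
(* Adding 1 keeps the denominator positive when [a i d] vanishes. *)
have n0 : 0 < `|a i d| + 1 by rewrite ltr_wpDl.
near=> e.
have e0 : 0 < e by near: e; exact: nbhs_right_gt.
have : e <= (b i - a i x) / (`|a i d| + 1).
  by near: e; apply: nbhs_right_le; rewrite divr_gt0.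
by rewrite ler_pdivlMr//; nra.
Unshelve. all: by end_near.
Qed.

(** Such a [d] makes [v] the midpoint of [v + e *: d] and [v - e *: d], which extremality then
    identifies. *)
Lemma vertex_active_rigid {R : realType} {E : lmodType R} {k : nat}
    {a : 'I_k -> {linear E -> R^o}} {b : 'I_k -> R} {v d : E} :
  vertices (polyhedron a b) v -> (forall i, i \in active a b v -> a i d = 0) ->
  d = 0.
Proof.
move=> [Cv ext] /(polyhedron_wiggle Cv) [e e0 [Cp Cq]].
have half : v = (1/2) *: (v + e *: d) + (1 - 1/2) *: (v - e *: d).
  have -> : 1 - 1/2 = 1/2 :> R by field.
  rewrite !scalerDr scalerN addrACA subrr addr0 -scalerDl.
  by have -> : 1/2 + 1/2 = 1 :> R; [field|rewrite scale1r].
have /addrI/eqP := ext _ _ (1/2) Cp Cq ltac:(lra) ltac:(lra) half.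
by rewrite -subr_eq0 opprK -scalerDl scaler_eq0 gt_eqF ?addr_gt0//= => /eqP.
Qed.

(** A vertex is determined by its active set: the active constraints all vanish on the difference of
    two vertices sharing one. There are finitely many such sets. *)
Lemma finite_vertices {R : realType} {E : lmodType R} {C : set E} :
  polyhedral_convex_set C -> finite_set (vertices C).
Proof.
move=> [k [a [b ->]]].
pose V := vertices (polyhedron a b).
pose pick (S : {set 'I_k}) : E := xget 0 [set v | V v /\ active a b v = S].
apply: (@sub_finite_set _ _ (range pick));
  last exact/finite_image/finite_finset.
move=> v Vv; exists (active a b v) => //; rewrite /pick.
case: xgetP => [w _ [Vw wv]|/(_ v) nv]; last by exfalso; exact: nv.
apply/eqP; rewrite -subr_eq0; apply/eqP/(vertex_active_rigid Vv) => i vi.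
rewrite linearB; apply/eqP; rewrite subr_eq0.
by move: vi (vi); rewrite -{1}wv !inE => /eqP -> /eqP ->.
Qed.

(** If [x] lies strictly between [p] and [q], a constraint active at [x] cannot be slack at either,
    so it vanishes on [p - q]. *)
Lemma nonvertex_direction {R : realType} {E : lmodType R} {k : nat}
    {a : 'I_k -> {linear E -> R^o}} {b : 'I_k -> R} {x : E} :
  polyhedron a b x -> ~ vertices (polyhedron a b) x ->
  exists2 d, d != 0 & forall i, i \in active a b x -> a i d = 0.
Proof.
move=> Cx; apply: contra_notP => H; split=> // p q t Cp Cq t0 t1 xE.
apply/eqP/negPn/negP => pq; apply: H; exists (p - q); first by rewrite subr_eq0.
move=> i; rewrite inE => /eqP; rewrite xE linearD !linearZ linearB /=.
rewrite /GRing.scale/=.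
have := Cp i; have := Cq i; nra.
Qed.

Lemma polyhedron_advance {R : realType} {E : lmodType R} {k : nat}
    {a : 'I_k -> {linear E -> R^o}} {b : 'I_k -> R} {x d : E} :
  polyhedron a b x -> (forall i, i \in active a b x -> a i d = 0) ->
  (exists i, 0 < a i d) ->
  exists2 s, 0 < s & polyhedron a b (x + s *: d) /\
    active a b x \proper active a b (x + s *: d).
Proof.
move=> Cx ad0 [i0 ai0].
(* Ratio test: [j] is the first constraint to become active along [d], and its ratio is the step
   length. *)
case: (@arg_minP _ R 'I_k i0 (fun i => 0 < a i d)
  (fun i => (b i - a i x) / a i d) ai0) => j aj jmin.
have jx : j \notin active a b x.
  by apply/negP => /ad0 H; move: aj; rewrite H ltxx.
exists ((b j - a j x) / a j d).
  by rewrite divr_gt0// subr_gt0 lt_neqAle Cx andbT; move: jx; rewrite inE.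
have [s0 sE] : 0 <= (b j - a j x) / a j d /\
    (b j - a j x) / a j d * a j d = b j - a j x.
  split; last by rewrite divfK// gt_eqF.
  by rewrite divr_ge0 ?(ltW aj)// subr_ge0.
move: s0 sE jmin; set s := (_ / _) => s0 sE jmin.
split.
  move=> i; rewrite linear_line; have [ai|ai] := ltP 0 (a i d).
    by have := jmin i ai; rewrite ler_pdivlMr//; lra.
  by have := Cx i; nra.
apply/properP; split.
  apply/fintype.subsetP => i ix; rewrite inE linear_line ad0// mulr0 addr0.
  by move: ix; rewrite inE.
by exists j => //; rewrite inE linear_line sE addrC subrK.
Qed.

(** * Minimizing a concave function at a vertex *)

Lemma concave_descent {R : realType} {E : lmodType R} {k : nat}
    {a : 'I_k -> {linear E -> R^o}} {b : 'I_k -> R} {F : E -> R} {M : R}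
    {v x : E} :
  concave_function (polyhedron a b) F ->
  (forall y, polyhedron a b y -> M <= F y) ->
  vertices (polyhedron a b) v ->
  polyhedron a b x -> ~ vertices (polyhedron a b) x ->
  exists y, [/\ polyhedron a b y, F y <= F x &
    active a b x \proper active a b y].
Proof.
move=> cF FM Vv Cx /(nonvertex_direction Cx) [d0 d0N0 ad0].
have {d0 d0N0 ad0} [d ad0 dpos] : exists2 d,
    (forall i, i \in active a b x -> a i d = 0) & exists i, 0 < a i d.
  (* The given vertex [v] is what excludes a line in the polyhedron: a direction on which every
     constraint vanishes is zero. *)
  have [i] : exists i, a i d0 != 0.
    apply: contrapT => H; move/eqP: d0N0; apply.
    apply: (vertex_active_rigid Vv) => i _.
    by apply/eqP/negPn/negP => ?; apply: H; exists i.
  rewrite neq_lt => /orP[ai|ai]; last by exists d0 => //; exists i.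
  exists (- d0) => [j /ad0 aj|]; first by rewrite linearN aj oppr0.
  by exists i; rewrite linearN oppr_gt0.
have [s s0 [Cp px]] := polyhedron_advance Cx ad0 dpos.
(* If both directions meet a new constraint, concavity prevents [F] from increasing at both ends.
   Otherwise the backward ray stays in the polyhedron and [concave_ray_min] applies. *)
have [dneg|dnneg] := pselect (exists i, 0 < a i (- d)).
  have adN0 i : i \in active a b x -> a i (- d) = 0.
    by move=> /ad0 ai; rewrite linearN ai oppr0.
  have [u u0 [Cq qx]] := polyhedron_advance Cx adN0 dneg.
  rewrite scalerN in Cq qx.
  have [le|lt] := leP (F (x + s *: d)) (F x); first by exists (x + s *: d).
  exists (x - u *: d); split=> //.
  by have := concave_chord cF s0 (ltW u0) Cp Cq; nra.
exists (x + s *: d); split=> //.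
apply: (concave_ray_min cF FM s0 Cp) => u u0 i.
rewrite -scaleNr linear_line.
have : 0 <= a i d.
  rewrite leNgt; apply/negP => ai; apply: dnneg; exists i.
  by rewrite linearN oppr_gt0.
by have := Cx i; nra.
Qed.

(** Each descent step activates a further constraint, so induction on the number of inactive ones
    ends at a vertex. *)
Lemma vertex_below {R : realType} {E : lmodType R} {C : set E} {F : E -> R}
    {M : R} {x : E} :
  polyhedral_convex_set C -> vertices C !=set0 -> concave_function C F ->
  (forall y, C y -> M <= F y) -> C x ->
  exists2 v, vertices C v & F v <= F x.
Proof.
move=> [k [a [b ->]]] [v Vv] cF FM.
have [n] := ubnP (#|~: active a b x|)%N; elim: n x => // n IH x.
move=> xn Cx; have [?|Vx] := pselect (vertices (polyhedron a b) x).
  by exists x.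
have [y [Cy yx xy]] := concave_descent cF FM Vv Cx Vx.
have [|w Vw wy] := IH y _ Cy; last by exists w => //; exact: le_trans yx.
by rewrite -ltnS; apply: leq_trans xn; rewrite ltnS proper_card// properC.
Qed.

Lemma finite_argmin {R : realType} {T : eqType} {A : set T} (F : T -> R) :
  finite_set A -> A !=set0 -> exists2 x, A x & forall y, A y -> F x <= F y.
Proof.
move=> /finite_seqP[s ->] [x0 /= x0s].
have [i imin] : exists i : 'I_(size s), forall j : 'I_(size s),
    F (nth x0 s i) <= F (nth x0 s j).
  have s0 : (index x0 s < size s)%N by rewrite index_mem.
  case: (@arg_minP _ R _ (Ordinal s0) xpredT
    (fun i => F (nth x0 s i)) isT) => i _ imin.
  by exists i => j; exact: imin.
exists (nth x0 s i); first exact: mem_nth.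
move=> y /= ys; have ys' : (index y s < size s)%N by rewrite index_mem.
by have := imin (Ordinal ys'); rewrite /= nth_index.
Qed.

Lemma concave_min_at_vertex {R : realType} {E : lmodType R} {C : set E}
    {F : E -> R} {M : R} :
  polyhedral_convex_set C -> vertices C !=set0 -> concave_function C F ->
  (forall y, C y -> M <= F y) ->
  exists2 v, vertices C v & global_solutions F C v.
Proof.
move=> PC VC cF FM.
have [v Vv vmin] := finite_argmin F (finite_vertices PC) VC.
exists v => //; split; first by case: Vv.
move=> x Cx; have [w Vw wx] := vertex_below PC VC cF FM Cx.
exact: le_trans (vmin w Vw) wx.
Qed.

(** * The lifted polyhedron [Omega1 K] *)

Lemma polyhedral_finType {R : realType} {E : lmodType R} {I : finType}
    (a : I -> {linear E -> R^o}) (b : I -> R) :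
  polyhedral_convex_set [set x | forall i, a i x <= b i].
Proof.
exists #|I|, (fun j => a (enum_val j)), (fun j => b (enum_val j)).
apply/seteqP; split=> x H i //=.
by have := H (enum_rank i); rewrite enum_rankK.
Qed.

Definition linear_pack {R : realType} {E : lmodType R} (g : E -> R^o)
    (lin_g : linear g) : {linear E -> R^o} :=
  HB.pack g (GRing.isLinear.Build R E R^o *:%R g lin_g).

Lemma Omega1_polyhedral {R : realType} {n m : nat}
    {K : set ('rV[R]_n * 'rV[R]_m)} :
  polyhedral_convex_set K -> polyhedral_convex_set (Omega1 K).
Proof.
move=> [k [a [b ->]]].
pose E : lmodType R := ('rV[R]_n * 'rV[R]_m * 'rV[R]_n)%type.
have linK i : linear (fun w : E => a i w.1).
  by move=> t u w; rewrite /= linearP.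
(* The bound on the absolute value splits into two linear constraints, with [sg] selecting the
   sign. *)
have linB (sg : bool) (j : 'I_n) : linear (fun w : E =>
    ((-1) ^+ sg * w.1.1 ord0 j - w.2 ord0 j : R^o)).
  by move=> t u w; rewrite /= !mxE /GRing.scale/=; ring.
pose A (c : 'I_k + bool * 'I_n) : {linear E -> R^o} :=
  match c with
  | inl i => linear_pack _ (linK i)
  | inr (sg, j) => linear_pack _ (linB sg j)
  end.
pose B (c : 'I_k + bool * 'I_n) : R := if c is inl i then b i else 0.
suff -> : Omega1 [set x | forall i, a i x <= b i] =
    [set w : E | forall c, A c w <= B c] by exact: polyhedral_finType.
apply/seteqP; split=> [w [Kw xz] [i|[sg j]]|w H]; first exact: Kw.
  rewrite /= subr_le0; apply: le_trans (xz j).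
  case: sg; rewrite ?expr1 ?expr0 ?mulN1r ?mul1r ?ler_norm//.
  by rewrite -normrN ler_norm.
split=> [i|j]; first exact: (H (inl i)).
have := H (inr (true, j)); have := H (inr (false, j)).
by rewrite /= !subr_le0 expr0 expr1 mul1r mulN1r ler_norml lerNl => -> ->.
Qed.

Definition abs_row {R : realType} {n : nat} (x : 'rV[R]_n) : 'rV[R]_n :=
  \row_i `|x ord0 i|.

Lemma Omega1_abs_row {R : realType} {n m : nat}
    {K : set ('rV[R]_n * 'rV[R]_m)} {p : 'rV[R]_n * 'rV[R]_m} :
  K p -> Omega1 K (p, abs_row p.1).
Proof. by move=> Kp; split=> // i; rewrite mxE. Qed.

(** Extremality of [p] fixes the first component of both endpoints. Each coordinate of [abs_row p.1]
    is then a mean of two numbers at least as large, hence equal to both. *)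
Lemma Omega1_vertex {R : realType} {n m : nat}
    {K : set ('rV[R]_n * 'rV[R]_m)} {p : 'rV[R]_n * 'rV[R]_m} :
  vertices K p -> vertices (Omega1 K) (p, abs_row p.1).
Proof.
move=> [Kp ext]; split; first exact: Omega1_abs_row.
move=> [pu zu] [pw zw] t [/= Ku zu_ge] [/= Kw zw_ge] t0 t1 [pE zE].
have puw := ext _ _ _ Ku Kw t0 t1 pE.
have pup : pu = p by rewrite pE -puw -scalerDl addrC subrK scale1r.
subst pw pu; congr pair; apply/rowP => i.
have := congr1 (fun z : 'rV_n => z ord0 i) zE; rewrite !mxE.
have := zu_ge i; have := zw_ge i; nra.
Qed.

(** * The penalized objective and its limit for large [theta] *)

Lemma penalized_concave {R : realType} {n m : nat} {lambda : R}
    {f : 'rV[R]_n * 'rV[R]_m -> R} {rho : R -> R}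
    {K : set ('rV[R]_n * 'rV[R]_m)} :
  0 <= lambda -> concave_function K f ->
  concave_function (E := R^o) [set t : R^o | 0 <= t] rho ->
  concave_function (Omega1 K) (fun w : 'rV[R]_n * 'rV[R]_m * 'rV[R]_n =>
    f w.1 + lambda * \sum_(i < n) rho (w.2 ord0 i)).
Proof.
move=> l0 /concave_functionP cf /concave_functionP cr.
apply/concave_functionP => [[p z] [q w]] t [/= Kp zp] [/= Kq wq] t01.
rewrite !mulrDr addrACA lerD ?cf//.
rewrite !(mulrCA _ lambda) -mulrDr ler_wpM2l// !mulr_sumr -big_split/=.
apply: ler_sum => i _; rewrite !mxE; apply: cr => //=.
  exact: le_trans (zp i).
exact: le_trans (wq i).
Qed.

Lemma sum_step_l0norm {R : realType} {n : nat} (x : 'rV[R]_n) :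
  \sum_(i < n) step (x ord0 i) = (l0norm x)%:R.
Proof.
rewrite /l0norm -sum1_card natr_sum [RHS]big_mkcond/=; apply: eq_bigr => i _.
by rewrite inE /step; case: eqP.
Qed.

Lemma penalized_cvg {R : realType} {n : nat} {r phi psi : R -> R -> R}
    (lambda c : R) (z : 'rV[R]_n) :
  admissible r phi psi ->
  c + lambda * \sum_(i < n) r theta (z ord0 i) @[theta --> +oo] -->
  c + lambda * (l0norm z)%:R.
Proof.
move=> adm; rewrite -sum_step_l0norm; apply: cvgD; first exact: cvg_cst.
apply: cvgMl_tmp; apply: cvg_big => [|i _].
  exact: add_continuous.
exact: adm_cvg adm _.
Qed.

Lemma l0norm_mono {R : realType} {n : nat} {x z : 'rV[R]_n} :
  (forall i, z ord0 i = 0 -> x ord0 i = 0) -> (l0norm x <= l0norm z)%N.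
Proof.
move=> xz; apply/subset_leq_card/fintype.subsetP => i.
by rewrite !inE; apply: contra_neq; exact: xz.
Qed.

Lemma penalized_bounded {R : realType} {n m : nat} {lambda M : R}
    {f : 'rV[R]_n * 'rV[R]_m -> R} {rho : R -> R}
    {K : set ('rV[R]_n * 'rV[R]_m)} :
  0 <= lambda -> (forall s t, 0 <= s -> s <= t -> rho s <= rho t) ->
  (forall p, K p -> M <= f p) ->
  forall w, Omega1 K w ->
    M + lambda * \sum_(i < n) rho 0 <=
    f w.1 + lambda * \sum_(i < n) rho (w.2 ord0 i).
Proof.
move=> l0 rhoS fM w [Kw wz]; rewrite lerD ?fM// ler_wpM2l//.
by apply: ler_sum => i _; apply: rhoS => //; exact: le_trans (wz i).
Qed.

(* A point [q] of [K] beating [w.1] beats [w] through its lift [(q, |q|)] as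
   soon as [theta] is large, by pointwise convergence of the penalties at the
   two points. *)
Lemma minimizer_eventually_l0_solution {R : realType} {n m : nat} {lambda : R}
    {f : 'rV[R]_n * 'rV[R]_m -> R} {r phi psi : R -> R -> R}
    {K : set ('rV[R]_n * 'rV[R]_m)} (w : 'rV[R]_n * 'rV[R]_m * 'rV[R]_n) :
  admissible r phi psi -> 0 <= lambda ->
  \forall theta \near +oo,
    global_solutions (fun w : 'rV[R]_n * 'rV[R]_m * 'rV[R]_n =>
      f w.1 + lambda * \sum_(i < n) r theta (w.2 ord0 i)) (Omega1 K) w ->
    l0_solutions lambda f K w.1.
Proof.
move=> adm l0.
have [sol|nsol] := pselect (l0_solutions lambda f K w.1).
  exact: nearW.
have [[Kw wz]|nOw] := pselect (Omega1 K w); last by apply: nearW => theta [].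
have [q Kq qw] : exists2 q, K q &
    f q + lambda * (l0norm q.1)%:R < f w.1 + lambda * (l0norm w.1.1)%:R.
  apply: contrapT => H; apply: nsol; split=> // q Kq; rewrite leNgt.
  by apply/negP => lt; apply: H; exists q.
set mid := f w.1 + lambda * (l0norm w.1.1)%:R in qw.
set a := f q + _ in qw.
(* Feasibility makes [x] vanish wherever [z] does, so the limit of the penalized values at [w] is at
   least the l0 value at [w.1]. *)
have le_mid : mid <= f w.1 + lambda * (l0norm w.2)%:R.
  rewrite lerD2l ler_wpM2l// ler_nat; apply: l0norm_mono => i z0.
  by apply/eqP; rewrite -normr_le0 -z0.
have qcvg := penalized_cvg lambda (f q) (abs_row q.1) adm.
have qabs : l0norm (abs_row q.1) = l0norm q.1.
  by apply/eqP; rewrite eqn_leq; apply/andP; split; apply: l0norm_mono => i;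
    rewrite !mxE => /eqP; rewrite ?normr_eq0 => /eqP -> //; rewrite normr0.
rewrite qabs in qcvg.
have wcvg := penalized_cvg lambda (f w.1) w.2 adm.
near=> theta => - [_ /(_ _ (Omega1_abs_row Kq)) /=].
(* The midpoint of [a < mid] separates the two limits. *)
have : f q + lambda * \sum_(i < n) r theta (abs_row q.1 ord0 i)
    < (a + mid) / 2.
  by near: theta; apply: cvgr_lt qcvg _ _; rewrite -/a; lra.
have : (a + mid) / 2 < f w.1 + lambda * \sum_(i < n) r theta (w.2 ord0 i).
  by near: theta; apply: cvgr_gt wcvg _ _; lra.
lra.
Unshelve. all: by end_near.
Qed.

Theorem corollary1 (R : realType) (n m : nat) (lambda : R)
    (f : 'rV[R]_n * 'rV[R]_m -> R) (r phi psi : R -> R -> R)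
    (K : set ('rV[R]_n * 'rV[R]_m)) :
  0 < lambda ->
  finite_dc f ->
  admissible r phi psi ->
  (forall theta : R, 0 < theta ->
     concave_function (E := R^o) [set t : R^o | 0 <= t] (r theta)) ->
  polyhedral_convex_set K ->
  vertices K !=set0 ->
  concave_function K f ->
  (exists M : R, forall p, K p -> M <= f p) ->
  [/\ polyhedral_convex_set (Omega1 K),
      vertices (Omega1 K) !=set0,
      forall theta : R, 0 < theta ->
        vertex_solutions lambda f K (r theta) !=set0
    & exists theta0 : R, 0 < theta0 /\
        forall theta : R, theta0 <= theta ->
          vertex_solutions lambda f K (r theta) `<=` l0_solutions lambda f K].
Proof.
move=> l0 _ adm cr PK [p0 Vp0] cf [M fM].
have PO := Omega1_polyhedral PK.
have VO : vertices (Omega1 K) !=set0.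
  by exists (p0, abs_row p0.1); exact: Omega1_vertex.
split=> //.
  move=> theta theta0.
  have [[p z] Vw minw] := concave_min_at_vertex PO VO
    (penalized_concave (ltW l0) cf (cr theta theta0))
    (penalized_bounded (ltW l0) (adm_nondecreasing adm theta0) fM).
  by exists p, z.
suff : \forall theta \near +oo, forall w, vertices (Omega1 K) w ->
    global_solutions (fun w : 'rV[R]_n * 'rV[R]_m * 'rV[R]_n =>
      f w.1 + lambda * \sum_(i < n) r theta (w.2 ord0 i)) (Omega1 K) w ->
    l0_solutions lambda f K w.1.
  (* [HA] holds strictly beyond [A], whence [A + 1]; the maximum with 1 makes the threshold
     positive. *)
  move=> [A [_ HA]]; exists (Num.max 1 (A + 1)); split.
    by rewrite lt_max ltr01.
  move=> theta; rewrite ge_max => /andP[_ At] p [z [Vw minw]].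
  by apply: (HA theta _ (p, z)) => //; lra.
have [s sE] := (finite_seqP _).1 (finite_vertices PO).
rewrite sE.
(* Indexing the vertices by a finite type lets [filter_forall] merge the thresholds of the single
   vertices into one. *)
suff : \forall theta \near +oo, forall i : 'I_(size s),
    global_solutions (fun w : 'rV[R]_n * 'rV[R]_m * 'rV[R]_n =>
      f w.1 + lambda * \sum_(i < n) r theta (w.2 ord0 i)) (Omega1 K)
      (nth (p0, 0) s i) ->
    l0_solutions lambda f K (nth (p0, 0) s i).1.
  apply: filterS => theta H w /= ws.
  have ws' : (index w s < size s)%N by rewrite index_mem.
  by have := H (Ordinal ws'); rewrite /= nth_index.
apply: filter_forall => i.
exact: (minimizer_eventually_l0_solution _ adm (ltW l0)).
Qed.
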